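(* Let $m\colon\mathbb N\to(0,\infty)$ be a fixed sequence such that $\lim_{i\to\infty}m_i=0$ and let $f\colon\mathbb R_{\ge 0}\to\mathbb R_{>0}$ be a smooth, bounded function with $\lim_{x\to\infty}f(x)=0$. On the space $\ell^2$ consider the weak Riemannian metrics $$G^1_x(u,u)=\langle u,u\rangle_{\ell^2_m}:=\sum_i m_i u_iu_i,\qquad G^2_x(u,u)=f(\|x\|^2_{\ell^2})\,\langle u,u\rangle_{\ell^2},$$ where $x\in\ell^2$ and $u\in T_x\ell^2=\ell^2$. Let $G=G^1*G^2$ be the metric on $\ell^2$ defined via infimal convolution of $G^1$ and $G^2$. Then $G^1$ and $G^2$ both have a non-degenerate geodesic distance function, but the geodesic distance of $G$ vanishes identically on all of $\ell^2$.
   Context: Here $\ell^2$ is the Hilbert space of real square-summable sequences. For two Riemannian metrics $G^1,G^2$ on a (possibly infinite-dimensional) manifold $\mathcal M$, the infimal convolution $G=G^1*G^2$ is defined for $x\in\mathcal M$, $\delta x\in T_x\mathcal M$ by $$G_x(\delta x,\delta x)=\inf\{G^1_x(v,v)+G^2_x(w,w): v,w\in T_x\mathcal M,\ v+w=\delta x\}.$$ The geodesic distance of a metric $G$ is $\operatorname{dist}^G(x,y)=\inf_\gamma\int_0^1\sqrt{G_{\gamma}(\dot\gamma,\dot\gamma)}\,dt$, the infimum over all (piecewise smooth) paths $\gamma:[0,1]\to\mathcal M$ from $x$ to $y$. It is non-degenerate if $\operatorname{dist}^G(x,y)>0$ whenever $x\neq y$; it vanishes identically if $\operatorname{dist}^G(x,y)=0$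 for all $x,y$. *)

(* Defs.v *)
From HB Require Import structures.
From mathcomp Require Import all_boot all_order all_algebra.
From mathcomp Require Import all_classical all_reals all_analysis.
From mathcomp Require Import ring lra.
Set Implicit Arguments.
Unset Strict Implicit.
Unset Printing Implicit Defensive.
Import Order.TTheory GRing.Theory Num.Theory.
Import numFieldNormedType.Exports.
Local Open Scope classical_set_scope.
Local Open Scope ring_scope.

Definition square_summable (R : realType) : {pred nat -> R} :=
  fun u => `[< cvgn [series u i ^+ 2]_i >].
Arguments square_summable {R}.

Record l2 (R : realType) := L2 {
  l2_seq :> nat -> R;
  l2P : l2_seq \in square_summable }.

HB.instance Definition _ (R : realType) := [isSub for @l2_seq R].
HB.instance Definition _ (R : realType) := [Choice of l2 R by <:].

Section SquareSummable.
Variable R : realType.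
Implicit Types u v : nat -> R.

Lemma square_summableP u :
  reflect (cvgn [series u i ^+ 2]_i) (u \in square_summable).
Proof. exact: asboolP. Qed.

Lemma square_summable_mul u v : u \in square_summable ->
  v \in square_summable -> cvgn [series u i * v i]_i.
Proof.
move=> /square_summableP su /square_summableP sv; apply: normed_cvg.
apply: (@series_le_cvg _ _ (fun i => u i ^+ 2 + v i ^+ 2)) => [n|n|n|].
- exact: normr_ge0.
- by rewrite addr_ge0 ?sqr_ge0.
- rewrite /= normrM -(real_normK (num_real (u n))) -(real_normK (num_real (v n))).
  have := sqr_ge0 (`|u n| - `|v n|); have := sqr_ge0 (`|u n| + `|v n|).
  nra.
- exact: (is_cvg_seriesD su sv).
Qed.

Fact square_summable_submod_closed : submod_closed (@square_summable R).
Proof.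
split.
  apply/square_summableP.
  rewrite (_ : [series _]_i = cst 0); first exact: is_cvg_cst.
  by apply/funext => n; rewrite /series/= big1// => i _; rewrite expr0n.
move=> a u v su sv; apply/square_summableP.
have /square_summableP su' := su; have /square_summableP sv' := sv.
have suv := square_summable_mul su sv.
pose w : R ^nat := a ^+ 2 *: [sequence u i ^+ 2]_i +
  (2 * a) *: [sequence u i * v i]_i + [sequence v i ^+ 2]_i.
have <- : w = [sequence (a *: u + v) i ^+ 2]_i.
  apply/funext => i.
  have E : a ^+ 2 * u i ^+ 2 + 2 * a * (u i * v i) + v i ^+ 2
         = (a * u i + v i) ^+ 2 by ring.
  exact: E.
exact: (is_cvg_seriesD (is_cvg_seriesD (is_cvg_seriesZ (k := a ^+ 2) su')
  (is_cvg_seriesZ (k := 2 * a) suv)) sv').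
Qed.

HB.instance Definition _ := GRing.isSubmodClosed.Build R (nat -> R)
  square_summable square_summable_submod_closed.

End SquareSummable.

HB.instance Definition _ (R : realType) :=
  [SubChoice_isSubLmodule of l2 R by <:].

Definition l2_dot (R : realType) (u v : l2 R) : R := limn [series u i * v i]_i.

Definition l2_norm (R : realType) (u : l2 R) : R := Num.sqrt (l2_dot u u).

Section L2Norm.
Variable R : realType.
Implicit Types (a : R) (u v w : l2 R).

Lemma l2_dotC u v : l2_dot u v = l2_dot v u.
Proof.
by congr (limn (series _)); apply/funext => i; rewrite /= mulrC.
Qed.

Lemma l2_dotDl u v w : l2_dot (u + v) w = l2_dot u w + l2_dot v w.
Proof.
have cu := square_summable_mul (l2P u) (l2P w).
have cv := square_summable_mul (l2P v) (l2P w).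
rewrite /l2_dot -(lim_seriesD cu cv); congr (limn (series _)).
by apply/funext => i; exact: mulrDl.
Qed.

Lemma l2_dotZl a u v : l2_dot (a *: u) v = a * l2_dot u v.
Proof.
have cu := square_summable_mul (l2P u) (l2P v).
rewrite /l2_dot -[a * _]/(a *: _) -(lim_seriesZ a cu); congr (limn (series _)).
by apply/funext => i; apply: esym; exact: mulrA.
Qed.

Lemma l2_dotDr u v w : l2_dot u (v + w) = l2_dot u v + l2_dot u w.
Proof. by rewrite l2_dotC l2_dotDl !(l2_dotC _ u). Qed.

Lemma l2_dotZr a u v : l2_dot u (a *: v) = a * l2_dot u v.
Proof. by rewrite l2_dotC l2_dotZl (l2_dotC v). Qed.

Lemma l2_dot_ge_coord u i : u i ^+ 2 <= l2_dot u u.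
Proof.
have cu := square_summable_mul (l2P u) (l2P u).
have ndu : nondecreasing_seq [series u i * u i]_i.
  apply/nondecreasing_seqP => n; rewrite /series/= big_nat_recr//=.
  by rewrite lerDl -expr2 sqr_ge0.
apply: (le_trans _ (nondecreasing_cvgn_le ndu cu i.+1)).
rewrite /series/= big_nat_recr//= expr2 lerDr.
by apply: sumr_ge0 => j _; rewrite -expr2 sqr_ge0.
Qed.

Lemma l2_dot_ge0 u : 0 <= l2_dot u u.
Proof. exact: le_trans (sqr_ge0 (u 0)) (l2_dot_ge_coord u 0). Qed.

Lemma l2_norm_ge0 u : 0 <= l2_norm u.
Proof. exact: sqrtr_ge0. Qed.

Lemma l2_norm_sqr u : l2_norm u ^+ 2 = l2_dot u u.
Proof. by rewrite sqr_sqrtr ?l2_dot_ge0. Qed.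

Lemma l2_norm_eq0 u : l2_norm u = 0 -> u = 0.
Proof.
move=> u0; apply/val_inj/funext => i /=.
have := l2_dot_ge_coord u i; rewrite -l2_norm_sqr u0 expr0n/= => ui.
by apply/eqP; rewrite -sqrf_eq0 eq_le ui sqr_ge0.
Qed.

Lemma l2_normZ a u : l2_norm (a *: u) = `|a| * l2_norm u.
Proof.
by rewrite /l2_norm l2_dotZl l2_dotZr mulrA -expr2 sqrtrM ?sqr_ge0// sqrtr_sqr.
Qed.

Lemma l2_dot_le_norm u v : l2_dot u v <= l2_norm u * l2_norm v.
Proof.
have [/l2_norm_eq0 ->|u0] := eqVneq (l2_norm u) 0.
  rewrite -[X in l2_dot X v](scale0r (0 : l2 R)) l2_dotZl mul0r.
  by rewrite mulr_ge0 ?l2_norm_ge0.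
have [/l2_norm_eq0 ->|v0] := eqVneq (l2_norm v) 0.
  rewrite -[X in l2_dot u X](scale0r (0 : l2 R)) l2_dotZr mul0r.
  by rewrite mulr_ge0 ?l2_norm_ge0.
have uv_gt0 : 0 < l2_norm u * l2_norm v.
  by rewrite mulr_gt0 ?lt_neqAle ?l2_norm_ge0 1?eq_sym ?u0 ?v0.
have := l2_dot_ge0 (l2_norm v *: u + - l2_norm u *: v).
rewrite !l2_dotDl !l2_dotDr !l2_dotZl !l2_dotZr (l2_dotC v u) -!l2_norm_sqr.
move: (l2_norm u) (l2_norm v) (l2_dot u v) uv_gt0 => a b c ab.
rewrite (_ : _ + _ = 2 * (a * b) * (a * b - c)); last by lra.
by rewrite pmulr_rge0 ?subr_ge0// mulr_gt0.
Qed.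

Lemma l2_normD u v : l2_norm (u + v) <= l2_norm u + l2_norm v.
Proof.
rewrite -(@ler_pXn2r _ 2) ?nnegrE ?addr_ge0 ?l2_norm_ge0//.
rewrite sqrrD !l2_norm_sqr l2_dotDl !l2_dotDr (l2_dotC v u).
by have := l2_dot_le_norm u v; lra.
Qed.

End L2Norm.

HB.instance Definition _ (R : realType) := Lmodule_isNormed.Build R (l2 R)
  (@l2_normD R) (@l2_normZ R) (@l2_norm_eq0 R).

Section Paths.
Variables (R : realType) (V : normedModType R).
Implicit Types (A : set R) (g c : R -> V).

(* At the points of A on its boundary these are one-sided derivatives. *)
Definition is_derive_within A g (t : R) (l : V) :=
  (s - t)^-1 *: (g s - g t) @[s --> within A t^'] --> l.

(* The D n are the successive derivatives of g on A; the values of g outside A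
   play no role. *)
Definition smooth_on A g := exists D : nat -> R -> V,
  (forall t, A t -> D 0 t = g t) /\
  (forall n t, A t -> is_derive_within A (D n) t (D n.+1 t)).

(* Consecutive closed pieces share a break point, so such a c is continuous
   on [0, 1]. *)
Definition piecewise_smooth c := exists2 s : seq R, itv_partition 0 1 s &
  forall i, (i < size s)%N ->
    smooth_on `[nth 0 (0 :: s) i, nth 0 (0 :: s) i.+1] c.

End Paths.

Section Metrics.
Variables (R : realType) (V : normedModType R).

(* A Riemannian metric G on the manifold V, all of whose tangent spaces are V,
   is given by its quadratic forms: G x u stands for G_x(u, u), which
   determines G_x by polarization. *)
Definition metric := V -> V -> R.
Implicit Types (G : metric) (x y : V).

Definition infimal_convolution (G1 G2 : metric) : metric := fun x u =>
  inf [set e | exists v w, v + w = u /\ e = G1 x v + G2 x w].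

(* The (junk) value of derive1 c at 0, at 1 and at the finitely many break points
   does not affect the integral. *)
Definition path_length G (c : R -> V) : \bar R :=
  (\int[lebesgue_measure]_(t in `[0%R, 1%R])
     (Num.sqrt (G (c t) (derive1 c t)))%:E)%E.

Definition geodesic_dist G x y : \bar R :=
  ereal_inf [set path_length G c | c in
    [set c : R -> V | [/\ piecewise_smooth c, c 0 = x & c 1 = y]]].

Definition nondegenerate_dist G :=
  forall x y, x <> y -> (0 < geodesic_dist G x y)%E.

Definition vanishing_dist G := forall x y, geodesic_dist G x y = 0%E.

End Metrics.

Definition metric1 (R : realType) (m : nat -> R) : metric (l2 R) :=
  fun _ u => limn [series m i * u i * u i]_i.

Definition metric2 (R : realType) (f : R -> R) : metric (l2 R) :=
  fun x u => f (`|x| ^+ 2) * l2_dot u u.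

(* Main.v *)
(** A potential [Phi] whose differential satisfies [|dPhi_z u| <= sqrt (G_z (u, u))]
    is 1-Lipschitz for the geodesic distance of [G]. For [G^1] the scaled
    coordinates [sqrt (m_i) z_i] separate points. For [G^2], to separate [x]
    from [y] with [r = |y - x|], take a multiple of the square of the positive
    part of [r^2 - |z - x|^2]: its differential vanishes outside the ball of
    radius [r] around [x], and on that ball [f] is bounded below.

    For the infimal convolution, deviate from the straight line from [x] to [y]
    by [lam t (1 - t) e_n], with [lam] large and then [n] large. Splitting the
    velocity as [lam (1 - 2 t) e_n] plus [y - x], the first part has
    [G^1]-energy at most [lam^2 m_n], and the second one has [G^2]-energy
    [f (|c t|^2) |y - x|^2], which is small except for [t] close to [0] or [1],
    where it is still bounded. *)

Require Import Defs.
From mathcomp Require Import all_boot all_order all_algebra.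
From mathcomp Require Import all_classical all_reals all_analysis.
From mathcomp Require Import ring lra measurable_realfun.
Import Order.TTheory GRing.Theory Num.Theory.
Import numFieldNormedType.Exports.
Local Open Scope classical_set_scope.
Local Open Scope ring_scope.

(** * Derivatives within a set: continuity, chain rule, comparison with [derive1] *)

Lemma nbhs_dnbhs_shift (R : numFieldType) (T : Type) (g : R -> T) (t : R) :
  (g (h + t)) @[h --> 0^'] = g @ t^'.
Proof.
rewrite funeqE => B; rewrite propeqE /nbhs/= /fmap/= /dnbhs/within/=.
rewrite !near_simpl (near_shift 0 t) /=.
split; apply: filterS => h /=; rewrite subr0; last first.
  by move=> + h0; apply; rewrite -subr_eq0 addrK.
by move=> + ht; apply; apply: contraNneq ht => ->; rewrite add0r.
Qed.

Section Within.
Context {R : realType} {V : normedModType R}.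
Implicit Types (A : set R) (g c : R -> V).

(** For s other than t, [g s] is (s - t) times the difference quotient, plus [g t]. The point t
    itself, excluded from the punctured filter, is added back at the end. *)
Lemma is_derive_within_cvg {A g t l} :
  is_derive_within A g t l -> g @ within A (nbhs t) --> g t.
Proof.
move=> gl.
have t0 : (s - t) @[s --> within A t^'] --> (0 : R).
  rewrite -[X in _ --> X](subrr t); apply: cvgB; last exact: cvg_cst.
  exact: (cvg_trans (cvg_within _) (cvg_within _)).
have gs : (s - t) *: ((s - t)^-1 *: (g s - g t)) + g t @[s --> within A t^'] --> g t.
  rewrite -[X in _ --> X]add0r -(scale0r l).
  by apply: cvgD; [exact: cvgZ|exact: cvg_cst].
have {}gs : g @ within A t^' --> g t.
  apply: cvg_trans gs; apply: near_eq_cvg.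
  rewrite near_withinE; near=> s => As /=.
  rewrite scalerA divff ?scale1r ?subrK// subr_eq0.
  by near: s; exact: nbhs_dnbhs_neq.
move=> P Pg; have {}gs : \forall s \near t, s != t -> A s -> P (g s) := gs P Pg.
suff : \forall s \near t, A s -> P (g s) by [].
apply: filterS gs => s gs As.
have [->|st] := eqVneq s t; first exact: nbhs_singleton.
exact: gs.
Unshelve. all: by end_near. Qed.

Lemma is_derive_within_derive {A g t l} : (interior A) t ->
  is_derive_within A g t l -> is_derive t 1 g l.
Proof.
move=> At gl.
have gl' : (s - t)^-1 *: (g s - g t) @[s --> t^'] --> l.
  apply: cvg_trans gl => P.
  move=> Pl; have PP : \forall s \near t, s != t -> A s -> P ((s - t)^-1 *: (g s - g t)) := Pl.
  suff : \forall s \near t, s != t -> P ((s - t)^-1 *: (g s - g t)) by [].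
  by move: At PP; apply: filterS2 => s /= As; auto.
have gl0 : h^-1 *: (g (h + t) - g t) @[h --> 0^'] --> l.
  have := gl'; rewrite -nbhs_dnbhs_shift; apply: cvg_trans.
  by apply: near_eq_cvg; near=> h; rewrite addrK.
have e : (fun h : R => h^-1 *: ((g \o shift t) (h *: (1 : R)) - g t)) =
    (fun h => h^-1 *: (g (h + t) - g t)).
  by apply/funext => h /=; rewrite [h *: 1]mulr1.
split; first by apply/cvg_ex; exists l; rewrite e.
by rewrite /derive e; apply: cvg_lim => //; exact: norm_hausdorff.
Unshelve. all: by end_near. Qed.

(** Chain rule with [L] as the differential of [Phi] at [g t]. Divided by s - t, the quadratic
    remainder is at most [C * |g s - g t| * |q s|] in absolute value, which tends to 0 since [g] is
    continuous at t within [A] and the quotient [q] converges. *)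
Lemma is_derive_within_comp {A g t l} (Phi L : V -> R) (C : R) :
  is_derive_within A g t l ->
  scalable L -> L @ l --> L l ->
  (forall z, `|Phi z - Phi (g t) - L (z - g t)| <= C * `|z - g t| ^+ 2) ->
  is_derive_within A (Phi \o g : R -> R^o) t (L l).
Proof.
move=> gl LZ Lc PhiL.
pose q s := (s - t)^-1 *: (g s - g t).
have gt : g s - g t @[s --> within A t^'] --> (0 : V).
  rewrite -[X in _ --> X](subrr (g t)); apply: cvgB; last exact: cvg_cst.
  move=> P /(is_derive_within_cvg gl) gP.
  have {}gP : \forall s \near t, A s -> P (g s) := gP.
  suff : \forall s \near t, s != t -> A s -> P (g s) by [].
  by apply: filterS gP => s gP _.
have Lq : L (q s) @[s --> within A t^'] --> L l.
  exact: (cvg_comp _ _ gl Lc).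
have rq : C * `|g s - g t| * `|q s| @[s --> within A t^'] --> (0 : R).
  rewrite -[X in _ --> X](_ : C * `|0 : V| * `|l| = 0); last first.
    by rewrite normr0 mulr0 mul0r.
  by apply: cvgM; [apply: cvgMr; exact: cvg_norm|exact: cvg_norm].
apply/cvgrPdist_lt => e e0.
have e20 : 0 < e / 2 by rewrite divr_gt0.
near=> s.
have st : s - t != 0.
  rewrite subr_eq0; near: s; rewrite near_withinE.
  by apply: filterS (nbhs_dnbhs_neq t) => x ? _.
have Lqs : `|L l - L (q s)| < e / 2.
  by near: s; move/cvgrPdist_lt: Lq; exact.
have rqs : `|0 - (C * `|g s - g t|) * `|q s|%R| < e / 2.
  by near: s; move/cvgrPdist_lt: rq; exact.
have := PhiL (g s).
have -> : g s - g t = (s - t) *: q s by rewrite scalerA divff// scale1r.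
rewrite LZ normrZ; move: rqs.
have -> : g s - g t = (s - t) *: q s by rewrite scalerA divff// scale1r.
rewrite sub0r normrN (normrZ (s - t) (q s)).
rewrite /= -[(s - t)^-1 *: _]/((s - t)^-1 * (Phi (g s) - Phi (g t))) [(s - t)^-1 * _]mulrC.
set D := Phi (g s) - Phi (g t); set Q := `|q s|; move=> rqs DL.
have u0 : 0 < `|s - t| by rewrite normr_gt0.
have {}DL : `|D / (s - t) - L (q s)| <= `|(C * (`|s - t| * Q) * Q)|.
  apply: le_trans (ler_norm _).
  rewrite -(ler_pM2l u0) -normrM mulrBr mulrCA divff// mulr1.
  by apply: le_trans DL _; rewrite le_eqVlt; apply/orP; left; apply/eqP; ring.
rewrite (_ : L l - _ = (L l - L (q s)) - (D / (s - t) - L (q s))); last by ring.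
apply: le_lt_trans (ler_normB _ _) _.
have := le_lt_trans DL rqs; lra.
Unshelve. all: by end_near. Qed.

Lemma smooth_on_derive {A c} : smooth_on A c ->
  exists2 D : R -> V, (forall t, A t -> is_derive_within A c t (D t)) &
    forall t, A t -> D @ within A (nbhs t) --> D t.
Proof.
(* [D 0] agrees with [c] only on [A], so the quotients of [c] and [D 0] are identified along the
   filter within [A]. *)
move=> [D [D0 DS]]; exists (D 1%N) => t At; last first.
  exact: is_derive_within_cvg (DS 1%N t At).
apply: cvg_trans (DS 0%N t At); apply: near_eq_cvg.
by rewrite near_withinE; near=> s => As; rewrite !D0.
Unshelve. all: by end_near. Qed.

End Within.

(** * Monotonicity of the integral for arbitrary nonnegative functions *)

Section NonMeasurable.
Context d (T : measurableType d) (R : realType).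
Variables (mu : {measure set T -> \bar R}) (D : set T).
Import HBNNSimple.
Local Open Scope ereal_scope.

(* The integral of a nonnegative function is a supremum over the simple
   functions below it, so monotonicity does not need measurability. *)
Lemma ge0_le_integral_nonmeasurable (f1 f2 : T -> \bar R) :
  (forall x, D x -> 0 <= f1 x) -> (forall x, D x -> f1 x <= f2 x) ->
  \int[mu]_(x in D) f1 x <= \int[mu]_(x in D) f2 x.
Proof.
move=> f10 f12.
have f20 x : D x -> 0 <= f2 x by move=> Dx; exact: le_trans (f10 x Dx) (f12 x Dx).
rewrite !ge0_integralE//; apply: le_ereal_sup => _ [h hf <-].
exists h => // x; apply: le_trans (hf x) _.
by rewrite /patch; case: ifPn => // /set_mem; exact: f12.
Qed.

End NonMeasurable.

(** * Potentials bound the geodesic distance from below *)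

Section Potential.
Context {R : realType} {V : normedModType R}.
Variables (Phi : V -> R) (dPhi : V -> V -> R).
(** Differentiability of [Phi] is expressed by a chain rule along curves; with the joint continuity
    of [dPhi] below, it makes [Phi \o c] continuously differentiable on each smooth piece of [c], up
    to the end points. *)
Hypothesis dPhiP : forall A (c : R -> V) t l, is_derive_within A c t l ->
  is_derive_within A (Phi \o c : R -> R^o) t (dPhi (c t) l).
Hypothesis dPhi_cvg : forall (F : set_system R) (FF : Filter F) (u v : R -> V) a b,
  u @ F --> a -> v @ F --> b -> dPhi (u s) (v s) @[s --> F] --> dPhi a b.
Notation mu := (@lebesgue_measure R).

(** This is the fundamental theorem of calculus for [Phi \o c], followed by the triangle inequality
    for integrals. Measurability is recorded because gluing pieces uses additivity of the
    integral. *)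
Lemma smooth_piece_le (c : R -> V) a b : a < b -> smooth_on `[a, b] c ->
  measurable_fun `[a, b] (fun t => `|dPhi (c t) (derive1 c t)|) /\
  (`|Phi (c b) - Phi (c a)|%:E <=
   \int[mu]_(t in `[a, b]) `|dPhi (c t) (derive1 c t)|%:E)%E.
Proof.
move=> ab /smooth_on_derive[D cD Dc].
(* With the one-sided derivative [D] instead of [derive1 c], the integrand is continuous on the
   closed interval; the two agree in the interior. *)
pose w t := dPhi (c t) (D t).
have wc : {within `[a, b], continuous w}.
  apply/subspace_continuousP => t tab.
  by apply: dPhi_cvg; [exact: is_derive_within_cvg (cD t tab)|exact: Dc].
have oo t : t \in `]a, b[ -> (interior `[a, b]) t.
  move=> tab; suff : `]a, b[ `<=` interior `[a, b] by exact.
  by rewrite -open_subsetE; [exact: subset_itvW|exact: interval_open].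
have ooc t : t \in `]a, b[ -> t \in `[a, b] by exact: subset_itvW.
have Phic t : t \in `[a, b] -> is_derive_within `[a, b] (Phi \o c : R -> R^o) t (w t).
  by move=> tab; exact: dPhiP (cD t tab).
have cc t : t \in `]a, b[ -> derive1 c t = D t.
  move=> tab; rewrite derive1E.
  by have [] := is_derive_within_derive (oo t tab) (cD t (ooc t tab)).
have Phi_cont : {within `[a, b], continuous (Phi \o c)}.
  by apply/subspace_continuousP => t tab; exact: is_derive_within_cvg (Phic t tab).
have Phi_der t : t \in `]a, b[ -> is_derive t 1 (Phi \o c : R -> R^o) (w t).
  by move=> tab; exact: is_derive_within_derive (oo t tab) (Phic t (ooc t tab)).
have dP : derivable_oo_LRcontinuous (Phi \o c : R -> R^o) a b.
  move/continuous_within_itvP : Phi_cont => /(_ ab)[_ ? ?].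
  by split => // t /Phi_der[].
have FTC : (\int[mu]_(t in `[a, b]) (w t)%:E = (Phi (c b))%:E - (Phi (c a))%:E)%E.
  apply: (continuous_FTC2 ab wc dP) => t /Phi_der[_ <-].
  by rewrite derive1E.
have mw : measurable_fun `[a, b] w.
  apply: subspace_continuous_measurable_fun => //.
have mwn : measurable_fun `[a, b] (fun t => `|w t|).
  exact: measurableT_comp.
have wE t : t \in `]a, b[ -> `|w t| = `|dPhi (c t) (derive1 c t)|.
  by move=> tab; rewrite cc.
have mwoo : measurable_fun `]a, b[ (fun t => `|dPhi (c t) (derive1 c t)|).
  apply: (@eq_measurable_fun _ _ _ _ _ (fun t => `|w t|)) => [t /set_mem /wE//|].
  by apply: measurable_funS mwn => //; exact: subset_itvW.
split; first exact: measurable_fun_itv_cc mwoo.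
have -> : (`|Phi (c b) - Phi (c a)|%:E = `|\int[mu]_(t in `[a, b]) (w t)%:E|)%E.
  by rewrite FTC.
apply: (@le_trans _ _ (\int[mu]_(t in `[a, b]) `|w t|%:E)%E).
  by apply: le_abse_integral => //; exact/measurable_EFinP.
(* Both integrals are moved to the open interval, where [D] is [derive1 c]; the end points are
   null. *)
rewrite [leLHS]integral_itv_bndoo; last first.
  by apply/measurable_EFinP; apply: measurable_funS mwn => //; exact: subset_itvW.
rewrite [leRHS]integral_itv_bndoo; last exact/measurable_EFinP.
rewrite le_eqVlt; apply/orP; left; apply/eqP.
by apply: eq_integral => t /set_mem /wE ->.
Qed.

Lemma piecewise_smooth_le (c : R -> V) (a : R) (s : seq R) : path <%R a s ->
  (forall i, (i < size s)%N ->
    smooth_on `[nth 0 (a :: s) i, nth 0 (a :: s) i.+1] c) ->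
  measurable_fun `[a, last a s] (fun t => `|dPhi (c t) (derive1 c t)|) /\
  (`|Phi (c (last a s)) - Phi (c a)|%:E <=
   \int[mu]_(t in `[a, last a s]) `|dPhi (c t) (derive1 c t)|%:E)%E.
Proof.
elim: s a => [a _ _|b s IH a /= /andP[ab bs] sm] /=.
  rewrite set_itv1; split; first exact: measurable_fun_set1.
  by rewrite subrr normr0 integral_ge0.
have [m1 i1] := smooth_piece_le c _ _ ab (sm 0%N isT).
have [m2 i2] := IH b bs (fun i si => sm i.+1 si).
set l := last b s in m2 i2 *; set w := fun t => `|dPhi (c t) _| in m1 m2 *.
have bl : b <= l.
  have : path <=%R b s by apply: sub_path bs => x y /ltW.
  rewrite le_path_sortedE/= => /andP[/allP sb _].
  by rewrite /l; case: (s) sb => [|x s' h] //=; apply: h; exact: mem_last.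
(* The second piece is taken half-open to make the union disjoint; restoring the point b later does
   not change its integral. *)
have U : `[a, l]%classic = `[a, b] `|` `]b, l].
  by rewrite -itv_bndbnd_setU// bnd_simp// ltW.
have m2' : measurable_fun `]b, l] w.
  by apply: measurable_funS m2 => //; apply: subset_itvr; rewrite bnd_simp.
have mU : measurable_fun `[a, l] w.
  by rewrite U; apply/measurable_funU.
split=> //.
rewrite U ge0_integral_setU//; last 2 first.
- by rewrite -U; exact/measurable_EFinP.
- rewrite disj_set2E; apply/eqP/seteqP; split => // x [/=].
  by rewrite !in_itv/= => /andP[_ xb] /andP[/lt_le_trans/(_ xb)]; rewrite ltxx.
apply: (@le_trans _ _ (`|Phi (c b) - Phi (c a)|%:E + `|Phi (c l) - Phi (c b)|%:E)%E).
  rewrite -EFinD lee_fin.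
  rewrite (_ : Phi (c l) - Phi (c a) =
    (Phi (c b) - Phi (c a)) + (Phi (c l) - Phi (c b))); last by ring.
  exact: ler_normD.
apply: leeD => //.
by rewrite integral_itv_obnd_cbnd//; exact/measurable_EFinP.
Qed.

(* [derive1 c t] is junk at the break points, but the bound on [dPhi] holds for
   every vector. *)
Lemma potential_le_path_length (G : metric V) (c : R -> V) :
  (forall z u, `|dPhi z u| <= Num.sqrt (G z u)) -> piecewise_smooth c ->
  (`|Phi (c 1%R) - Phi (c 0%R)|%:E <= path_length G c)%E.
Proof.
move=> dG [s [ps /eqP sl] sm].
have [_] := piecewise_smooth_le c 0 s ps sm; rewrite sl => h.
apply: le_trans h _; apply: ge0_le_integral_nonmeasurable => t _ /=.
  by rewrite lee_fin.
by rewrite lee_fin.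
Qed.

(** The bound for a single path is uniform, so it passes to the infimum. Non-degeneracy is thereby
    reduced to finding such a [Phi] with distinct values at x and y. *)
Lemma potential_le_geodesic_dist (G : metric V) (x y : V) :
  (forall z u, `|dPhi z u| <= Num.sqrt (G z u)) ->
  (`|Phi y - Phi x|%:E <= geodesic_dist G x y)%E.
Proof.
move=> dG; apply: le_ereal_inf_tmp => _ [c [pc <- <-] <-].
exact: potential_le_path_length.
Qed.

End Potential.

(** * Continuity in [l2], and non-degeneracy of the two metrics *)

Section L2.
Context {R : realType}.
Implicit Types (u v x y z : l2 R) (m : nat -> R).

Lemma l2_normE u : `|u| ^+ 2 = l2_dot u u.
Proof. exact: l2_norm_sqr. Qed.

(** Polarization gives the joint continuity of the inner product from that of the norm. *)
Lemma l2_dot_polar u v : l2_dot u v = (`|u + v| * `|u + v| - `|u - v| * `|u - v|) / 4.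
Proof.
rewrite -[- v]scaleN1r.
rewrite -!expr2 !l2_normE !(l2_dotDl, l2_dotDr, l2_dotZl, l2_dotZr) (l2_dotC v u).
by field.
Qed.

Lemma l2_dot_cvg (T : Type) (F : set_system T) (FF : Filter F) (u v : T -> l2 R) (a b : l2 R) :
  u @ F --> a -> v @ F --> b -> l2_dot (u s) (v s) @[s --> F] --> l2_dot a b.
Proof.
move=> ua vb.
under eq_fun do rewrite l2_dot_polar; rewrite l2_dot_polar.
apply: cvgM; last exact: cvg_cst.
apply: cvgB; apply: cvgM;
  apply: cvg_norm; by [exact: cvgD|exact: cvgB].
Qed.

Lemma l2_coord_le u i : `|u i| <= `|u|.
Proof.
rewrite -(@ler_pXn2r _ 2) ?nnegrE// l2_normE real_normK ?num_real//.
exact: l2_dot_ge_coord.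
Qed.

Lemma l2_coord_cvg (T : Type) (F : set_system T) (FF : Filter F) (u : T -> l2 R) (a : l2 R) i :
  u @ F --> a -> u s i @[s --> F] --> a i.
Proof.
move=> ua; apply/cvgrPdist_lt => e e0; near=> s.
apply: le_lt_trans (l2_coord_le (a - u s) i) _.
by near: s; move/cvgrPdist_lt : ua; exact.
Unshelve. all: by end_near. Qed.

Lemma cvg0_bounded m : m i @[i --> \oo] --> 0 -> exists B, forall i, `|m i| <= B.
Proof.
move=> m0.
have : bounded_fun m.
  by apply: cvg_seq_bounded; apply/cvg_ex; exists 0.
by move=> /pinfty_ex_gt0[B _ mB]; exists B => i; exact: mB.
Qed.

(** Comparison with [B] times the series of squares, [B] a bound for [m]. This makes the limit in
    [metric1] a genuine sum. *)
Lemma metric1_cvg m u : m i @[i --> \oo] --> 0 -> cvgn [series m i * u i * u i]_i.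
Proof.
move=> /cvg0_bounded[B mB]; apply: normed_cvg.
apply: (@series_le_cvg _ _ (fun i => B *: (u i * u i))) => [n|n|n|].
- exact: normr_ge0.
- rewrite /= mulr_ge0// -?expr2 ?sqr_ge0//; exact: le_trans (mB 0%N).
- rewrite /= -mulrA normrM ler_pM// -expr2 ger0_norm ?sqr_ge0//.
- apply: is_cvg_seriesZ; exact: square_summable_mul (l2P u) (l2P u).
Qed.

Lemma metric1_ge_coord m x u i : (forall i, 0 < m i) -> m i @[i --> \oo] --> 0 ->
  m i * u i ^+ 2 <= metric1 m x u.
Proof.
move=> m0 /(metric1_cvg m u) cu.
have t0 j : 0 <= m j * u j * u j by rewrite -mulrA -expr2 mulr_ge0 ?sqr_ge0// ltW.
have ndu : nondecreasing_seq [series m i * u i * u i]_i.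
  apply/nondecreasing_seqP => n; rewrite /series/= big_nat_recr//=.
  by rewrite lerDl t0.
(* The partial sum of index [i.+1] is the first that contains the term of index i. *)
apply: (le_trans _ (nondecreasing_cvgn_le ndu cu i.+1)).
rewrite /series/= big_nat_recr//= expr2 mulrA lerDr.
by apply: sumr_ge0 => j _; exact: t0.
Qed.

Lemma metric1_nondegenerate m : (forall i, 0 < m i) -> m i @[i --> \oo] --> 0 ->
  nondegenerate_dist (metric1 m).
Proof.
move=> m0 mc x y xy.
have [i xyi] : exists i, x i != y i.
  apply: contrapT => /forallNP xyE; apply: xy; apply/val_inj/funext => i.
  by apply/eqP/negPn/negP; exact: xyE.
pose Phi (z : l2 R) := Num.sqrt (m i) * z i.
apply: (@lt_le_trans _ _ (`|Phi y - Phi x|%:E)).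
  rewrite lte_fin normr_gt0 /Phi -mulrBr mulf_neq0//; last by rewrite subr_eq0 eq_sym.
  by rewrite gt_eqF ?sqrtr_gt0.
have PhiB u v : Phi (u - v) = Phi u - Phi v by rewrite /Phi mulrBr.
have Phi_cvg (T : Type) (F : set_system T) (FF : Filter F) (u : T -> l2 R) (a : l2 R) :
    u @ F --> a -> Phi (u s) @[s --> F] --> Phi a.
  by move=> ua; apply: cvgM; [exact: cvg_cst|exact: l2_coord_cvg].
(* [Phi] is linear and continuous, hence its own differential, with remainder constant 0. *)
apply: (@potential_le_geodesic_dist _ _ Phi (fun _ u => Phi u)).
- move=> A c t l cl; apply: (is_derive_within_comp Phi Phi 0) => //.
  + by move=> a u; rewrite /Phi/= mulrCA.
  + exact: (Phi_cvg _ (nbhs l) (nbhs_filter l) idfun l (@cvg_id _ (nbhs l))).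
  + by move=> z; rewrite PhiB subrr normr0 mul0r.
- by move=> F FF u v a b _; exact: Phi_cvg.
- move=> z u; rewrite /Phi normrM ger0_norm ?sqrtr_ge0//.
  rewrite -sqrtr_sqr -sqrtrM ?(ltW (m0 i))//; apply: ler_wsqrtr.
  exact: metric1_ge_coord.
Qed.

Lemma smooth_on_pos_min (f : R -> R) (M : R) : 0 <= M -> smooth_on [set t : R | 0 <= t] f ->
  (forall t : R, 0 <= t -> 0 < f t) ->
  exists2 e, 0 < e & forall t : R, 0 <= t <= M -> e <= f t.
Proof.
move=> M0 /smooth_on_derive[D fD _] f0.
have cf : {within `[0, M], continuous f}.
  apply/subspace_continuousP => t; rewrite /= in_itv/= => /andP[t0 tM].
  have := is_derive_within_cvg (fD t t0); apply: cvg_trans; apply: cvg_app.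
  by apply: within_subset => z/=; rewrite in_itv/= => /andP[].
have [z /[!in_itv]/= /andP[z0 _] fz] := EVT_min M0 cf.
by exists (f z); [exact: f0|move=> x xM; apply: fz; rewrite in_itv].
Qed.

(** This is max(a, 0), written so that its continuity follows from that of the absolute value. *)
Definition pospart (a : R) : R := (a + `|a|) / 2.

Lemma pospart_eq0 (a : R) : a <= 0 -> pospart a = 0.
Proof. by move=> a0; rewrite /pospart ler0_norm// subrr mul0r. Qed.

Lemma pospart_id (a : R) : 0 <= a -> pospart a = a.
Proof. by move=> a0; rewrite /pospart ger0_norm//; field. Qed.

(** The square of the positive part is differentiable with derivative [2 * pospart b], and its
    Taylor remainder is quadratic across the kink at 0 too. For mixed signs the remainder is a^2 or
    (a - b)^2 - a^2. *)
Lemma pospart_quad (a b : R) :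
  `|pospart a ^+ 2 - pospart b ^+ 2 - 2 * pospart b * (a - b)| <= (a - b) ^+ 2.
Proof.
have [a0|a0] := leP 0 a; have [b0|b0] := leP 0 b.
- rewrite !pospart_id//.
  rewrite (_ : a ^+ 2 - _ - _ = (a - b) ^+ 2); last by ring.
  by rewrite ger0_norm ?sqr_ge0.
- rewrite (pospart_id _ a0) (pospart_eq0 _ (ltW b0)).
  rewrite expr0n/= mulr0 mul0r !subr0 ger0_norm ?sqr_ge0//.
  rewrite ler_pXn2r ?nnegrE// ?subr_ge0; lra.
- rewrite (pospart_id _ b0) (pospart_eq0 _ (ltW a0)).
  rewrite (_ : 0 ^+ 2 - _ - _ = b * (b - 2 * a)); last by ring.
  rewrite ger0_norm; last by apply: mulr_ge0 => //; lra.
  by rewrite (_ : (a - b) ^+ 2 = b * (b - 2 * a) + a ^+ 2) ?lerDl ?sqr_ge0//; ring.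
- rewrite (pospart_eq0 _ (ltW a0)) (pospart_eq0 _ (ltW b0)) expr0n/= mulr0 mul0r !subr0 normr0.
  exact: sqr_ge0.
Qed.

Lemma l2_dot_norm_le u v : `|l2_dot u v| <= `|u| * `|v|.
Proof.
rewrite ler_norml l2_dot_le_norm andbT lerNl.
rewrite -[leLHS]mulN1r -l2_dotZl scaleN1r -[`|u|]normrN; exact: l2_dot_le_norm.
Qed.

Lemma metric2_nondegenerate (f : R -> R) :
  (forall t : R, 0 <= t -> 0 < f t) -> smooth_on [set t : R | 0 <= t] f ->
  nondegenerate_dist (metric2 f).
Proof.
move=> f0 sf x y /eqP xy.
pose r := `|y - x|.
have r0 : 0 < r by rewrite normr_gt0 subr_eq0 eq_sym.
(* The ball of radius r around x lies in the ball of radius [|x| + r] around 0, so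
   [f (|z| ^+ 2) >= e] on it. *)
have [e e0 fe] := smooth_on_pos_min f ((`|x| + r) ^+ 2) (sqr_ge0 _) sf f0.
(* On the ball, [p z <= r ^+ 2] and [|z - x| <= r], so [|dPhi z u|] is at most
   [4 * k * r ^+ 3 * |u|]; this [k] turns that into [sqrt e * |u|]. *)
pose k := Num.sqrt e / (4 * r ^+ 3).
have k0 : 0 < k by rewrite divr_gt0 ?sqrtr_gt0// mulr_gt0// exprn_gt0.
pose p (z : l2 R) := r ^+ 2 - l2_dot (z - x) (z - x).
pose dp (z u : l2 R) := - 2 * l2_dot (z - x) u.
pose Phi z := k * pospart (p z) ^+ 2.
pose dPhi z u := k * (2 * pospart (p z)) * dp z u.
apply: (@lt_le_trans _ _ (`|Phi y - Phi x|%:E)).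
  have py : p y = 0 by rewrite /p -l2_normE subrr.
  have px : p x = r ^+ 2 by rewrite /p -l2_normE (subrr x) normr0 expr0n/= subr0.
  rewrite lte_fin /Phi py px pospart_eq0// pospart_id ?sqr_ge0// expr0n/= mulr0.
  by rewrite sub0r normrN normr_gt0 mulf_neq0// ?gt_eqF ?exprn_gt0.
have dp_cvg (T : Type) (F : set_system T) (FF : Filter F) (u v : T -> l2 R) (a b : l2 R) :
    u @ F --> a -> v @ F --> b -> dp (u s) (v s) @[s --> F] --> dp a b.
  move=> ua vb; apply: cvgM; first exact: cvg_cst.
  by apply: l2_dot_cvg => //; apply: cvgB => //; exact: cvg_cst.
have p_cvg (T : Type) (F : set_system T) (FF : Filter F) (u : T -> l2 R) (a : l2 R) :
    u @ F --> a -> p (u s) @[s --> F] --> p a.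
  move=> ua; apply: cvgB; first exact: cvg_cst.
  by apply: l2_dot_cvg; apply: cvgB => //; exact: cvg_cst.
apply: (@potential_le_geodesic_dist _ _ Phi dPhi).
- move=> A c t l cl.
  have pl : is_derive_within A (p \o c : R -> R^o) t (dp (c t) l).
    apply: (is_derive_within_comp p (dp (c t)) 1 cl) => [a u|z|].
    + by rewrite /dp l2_dotZr mulrCA.
    + exact: (dp_cvg _ (nbhs l) (nbhs_filter l) (cst (c t)) idfun (c t) l
        (cvg_cst _) (@cvg_id _ (nbhs l))).
    + move=> z.
      (* [p] is a quadratic polynomial, so its second-order remainder is exact. *)
      have -> : p z - p (c t) - dp (c t) (z - c t) = - l2_dot (z - c t) (z - c t).
        rewrite /p /dp -[z - x](subrKA (c t)).
        move: (z - c t) (c t - x) => v w.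
        rewrite !(l2_dotDl, l2_dotDr) (l2_dotC w v); ring.
      by rewrite normrN ger0_norm ?l2_dot_ge0// mul1r l2_normE.
  (* Second use of the chain rule, now for the scalar function [k * pospart s ^+ 2] along
     [p \o c]. *)
  have := is_derive_within_comp (V := R^o) (fun s => k * pospart s ^+ 2)
    (fun h => k * (2 * pospart (p (c t))) * h) k pl.
  rewrite -[X in _ -> _ -> _ -> X]/(is_derive_within A (Phi \o c : R -> R^o) t (dPhi (c t) l)).
  apply => [a u||s].
  + by rewrite /= mulrCA.
  + by apply: cvgM; [exact: cvg_cst|exact: cvg_id].
  + have -> : k * pospart s ^+ 2 - k * pospart ((p \o c) t) ^+ 2 -
        k * (2 * pospart (p (c t))) * (s - (p \o c) t) =
        k * (pospart s ^+ 2 - pospart (p (c t)) ^+ 2 - 2 * pospart (p (c t)) * (s - p (c t))).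
      by rewrite /=; ring.
    rewrite normrM gtr0_norm// ler_pM2l// real_normK ?num_real//.
    exact: pospart_quad.
- move=> F FF u v a b ua vb; apply: cvgM; last exact: dp_cvg.
  apply: cvgM; first exact: cvg_cst.
  apply: cvgM; first exact: cvg_cst.
  apply: cvgM; last exact: cvg_cst.
  by apply: cvgD; [exact: p_cvg|apply: cvg_norm; exact: p_cvg].
- move=> z u; rewrite /dPhi.
  have [pz|pz] := leP (p z) 0.
    by rewrite pospart_eq0// !(mulr0, mul0r) normr0 sqrtr_ge0.
  rewrite (pospart_id _ (ltW pz)).
  have zx : `|z - x| <= r.
    rewrite -(@ler_pXn2r _ 2) ?nnegrE ?(ltW r0)// l2_normE -subr_ge0; exact: ltW.
  have pr : p z <= r ^+ 2 by rewrite lerBlDr lerDl l2_dot_ge0.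
  have fz : e <= f (`|z| ^+ 2).
    apply: fe; rewrite sqr_ge0/= ler_pXn2r ?nnegrE ?addr_ge0 ?(ltW r0)//.
    by rewrite -[z](subrK x) addrC; apply: le_trans (ler_normD _ _) _; rewrite lerD2l.
  rewrite /metric2 sqrtrM ?(ltW (f0 _ (sqr_ge0 _)))// -l2_normE sqrtr_sqr normr_id.
  apply: (@le_trans _ _ (Num.sqrt e * `|u|)); last first.
    by rewrite ler_wpM2r// ler_wsqrtr.
  have kp : 0 < k * (2 * p z) by apply: mulr_gt0 => //; exact: mulr_gt0.
  rewrite normrM (gtr0_norm kp) /dp normrM normrN (ger0_norm (ler0n _ 2)).
  have -> : Num.sqrt e = k * (2 * r ^+ 2) * (2 * r).
    by rewrite /k; field; rewrite gt_eqF.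
  apply: (@le_trans _ _ (k * (2 * r ^+ 2) * (2 * (r * `|u|)))); last first.
    by rewrite le_eqVlt; apply/orP; left; apply/eqP; ring.
  apply: ler_pM; [exact: ltW|exact: mulr_ge0| |].
    by rewrite ler_pM2l// ler_pM2l.
  rewrite ler_pM2l//; apply: le_trans (l2_dot_norm_le _ _) _.
  by rewrite ler_wpM2r.
Qed.

End L2.

(** * Quadratic paths, and elementary bounds for infimal convolution and distance *)

Section Quadratic.
Context {R : realType} {V : normedModType R}.
Implicit Types (a b d : V) (s t : R) (A : set R).

(** A family of paths closed under differentiation; it contains the straight line with a bump
    [t * (1 - t)] added. *)
Definition quad a b d s : V := a + s *: b + s ^+ 2 *: d.

Lemma quad_derive A a b d t :
  is_derive_within A (quad a b d) t (quad b (2 *: d) 0 t).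
Proof.
have -> : quad b (2 *: d) 0 t = b + (t + t) *: d.
  by rewrite /quad scaler0 addr0 scalerA mulrC mulr_natl mulr2n.
have lim : b + (s + t) *: d @[s --> within A t^'] --> b + (t + t) *: d.
  apply: cvgD; first exact: cvg_cst.
  apply: cvgZ; last exact: cvg_cst.
  apply: cvgD; last exact: cvg_cst.
  exact: (cvg_trans (cvg_within _) (cvg_within _)).
apply: cvg_trans lim; apply: near_eq_cvg; rewrite near_withinE; near=> s => As.
have st : s - t != 0 by rewrite subr_eq0; near: s; exact: nbhs_dnbhs_neq.
apply: (scalerI st); rewrite scalerA divff// scale1r /quad.
have -> : a + s *: b + s ^+ 2 *: d - (a + t *: b + t ^+ 2 *: d) =
    (s *: b - t *: b) + (s ^+ 2 *: d - t ^+ 2 *: d).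
  by rewrite opprD addrACA opprD (addrACA a) subrr add0r.
by rewrite scalerDr scalerA -subr_sqr !scalerBl.
Unshelve. all: by end_near. Qed.

Lemma quad_smooth A a b d : smooth_on A (quad a b d).
Proof.
exists (fun n => match n with 0 => quad a b d | 1 => quad b (2 *: d) 0
  | 2 => quad (2 *: d) 0 0 | _ => quad 0 0 0 end); split=> // n t _.
case: n => [|[|[|n]]] /=; first exact: quad_derive.
- by have := quad_derive A b (2 *: d) 0 t; rewrite scaler0.
- by have := quad_derive A (2 *: d) 0 0 t; rewrite scaler0.
- by have := quad_derive A 0 0 0 t; rewrite scaler0.
Qed.

Lemma quad_derive1 a b d t : derive1 (quad a b d) t = quad b (2 *: d) 0 t.
Proof.
have it : (interior setT) t by rewrite interiorT.
by rewrite derive1E; have [] := is_derive_within_derive it (quad_derive setT a b d t).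
Qed.

Lemma quad_piecewise_smooth a b d : piecewise_smooth (quad a b d).
Proof.
exists [:: 1]; first by split => //=; rewrite ltr01.
by move=> i _; exact: quad_smooth.
Qed.

(** The infimum is a real one, a lower bound only for sets bounded below; nonnegativity supplies the
    bound 0. *)
Lemma infimal_convolution_le (G1 G2 : metric V) (x v w : V) :
  (forall u, 0 <= G1 x u) -> (forall u, 0 <= G2 x u) ->
  infimal_convolution G1 G2 x (v + w) <= G1 x v + G2 x w.
Proof.
move=> G10 G20; apply: ge_inf; last by exists v, w.
by exists 0 => _ [v' [w' [_ ->]]]; exact: addr_ge0.
Qed.

Lemma geodesic_dist_ge0 (G : metric V) (x y : V) : (0 <= geodesic_dist G x y)%E.
Proof.
apply: le_ereal_inf_tmp => _ [c _ <-].
by apply: integral_ge0 => t _; rewrite lee_fin sqrtr_ge0.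
Qed.

End Quadratic.

(** * Integrals over [0, 1] of functions that are small away from the end points *)

Section EndBumps.
Context {R : realType}.
Notation mu := (@lebesgue_measure R).

(** [F] lies below the step function [B], equal to [h] plus [C] times the indicators of two end
    intervals of length [d]. Only [B] is integrated explicitly, so [F] may be the speed for an
    infimal convolution, whose measurability is not established. *)
Lemma le_integral_end_bumps (F : R -> R) (h C d : R) :
  0 <= h -> 0 <= C -> 0 < d ->
  (forall t, 0 <= F t) ->
  (forall t, 0 <= t <= 1 -> F t <= h + C) ->
  (forall t, d <= t <= 1 - d -> F t <= h) ->
  (\int[mu]_(t in `[0%R, 1%R]) (F t)%:E <= (h + C * (2 * d))%:E)%E.
Proof.
move=> h0 C0 d0 F0 FC Fh.
pose I1 := `[0, d]%classic : set R; pose I2 := `[1 - d, 1]%classic : set R.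
pose B t := (h%:E + (C%:E * (\1_I1 t)%:E + C%:E * (\1_I2 t)%:E))%E.
have mI1 : measurable I1 by exact: measurable_itv.
have mI2 : measurable I2 by exact: measurable_itv.
have i0 (I : set R) t : (0 <= C%:E * (\1_I t)%:E)%E.
  by rewrite mule_ge0// lee_fin.
have mi (I : set R) : measurable I ->
    measurable_fun (`[0, 1]%classic : set R) (fun t => C%:E * (\1_I t)%:E)%E.
  by move=> mI; apply: measurable_funeM; apply/measurable_EFinP; exact: measurable_indic.
apply: (@le_trans _ _ (\int[mu]_(t in `[0%R, 1%R]) B t)%E).
  apply: ge0_le_integral_nonmeasurable => t; rewrite /= in_itv/= => /andP[t0 t1].
    by rewrite lee_fin.
  rewrite /B -!EFinM -!EFinD lee_fin !indicE.
  have FC' := FC t; have Fh' := Fh t.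
  have [I1t|/negP I1t] := boolP (t \in I1); first by
    apply: le_trans (FC' _) _; rewrite ?t0// mulr1 lerD2l lerDl mulr_ge0.
  have [I2t|/negP I2t] := boolP (t \in I2); first by
    apply: le_trans (FC' _) _; rewrite ?t0// mulr1 lerD2l lerDr mulr_ge0.
  rewrite !mulr0 !addr0; apply: Fh'.
  apply/andP; split; rewrite leNgt; apply/negP => td.
    by apply: I1t; rewrite inE /I1/= in_itv/= t0 ltW.
  by apply: I2t; rewrite inE /I2/= in_itv/= t1 ltW.
rewrite ge0_integralD//; last 2 first.
- by move=> t _; rewrite adde_ge0.
- by apply: emeasurable_funD; exact: mi.
rewrite integral_cst//= lebesgue_measure_itv/= lte_fin ltr01 oppr0 adde0 mule1.
rewrite ge0_integralD//; [|exact: mi|exact: mi].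
rewrite !ge0_integralZl//=; last 2 first.
- by apply/measurable_EFinP; exact: measurable_indic.
- by apply/measurable_EFinP; exact: measurable_indic.
rewrite !integral_indic//= EFinD leeD2l// (_ : C * (2 * d) = C * d + C * d); last by ring.
have muI (I : set R) : measurable I -> mu I = d%:E -> (mu (I `&` `[0%R, 1%R]) <= d%:E)%E.
  by move=> mI <-; apply: le_measure => //=; rewrite ?inE//; exact: measurableI.
rewrite EFinD EFinM leeD// lee_wpmul2l ?lee_fin// muI//=.
  by rewrite lebesgue_measure_itv/= lte_fin d0 sube0.
rewrite lebesgue_measure_itv/= lte_fin ltrBlDr ltrDl d0 -EFinD; congr (_%:E); ring.
Qed.

End EndBumps.

(** * Vanishing of the distance of the infimal convolution *)

Section Vanishing.
Context {R : realType}.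
Implicit Types (m : nat -> R) (n : nat).

Lemma series_single_cvg (u : nat -> R) n : (forall i, i != n -> u i = 0) ->
  series u @ \oo --> u n.
Proof.
move=> un; apply: cvg_near_cst; near=> N.
rewrite /series/= (bigD1_seq n) ?iota_uniq//=; last first.
  by rewrite mem_index_iota; near: N; exact: nbhs_infty_gt.
by rewrite big1 ?addr0.
Unshelve. all: by end_near. Qed.

Fact l2_basis_subproof n : (fun i => (i == n)%:R : R) \in square_summable.
Proof.
apply/square_summableP/cvg_ex; exists ((n == n)%:R ^+ 2).
apply: (@series_single_cvg (fun i => (i == n)%:R ^+ 2)) => i /negbTE ->.
by rewrite expr0n.
Qed.

Definition l2_basis n : l2 R := L2 (l2_basis_subproof n).

Lemma l2_basis_norm n : `|l2_basis n| = 1.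
Proof.
apply/eqP; rewrite -(@eqrXn2 _ 2)// l2_normE expr1n; apply/eqP.
rewrite /l2_dot; apply: cvg_lim => //.
have := @series_single_cvg (fun i => l2_basis n i * l2_basis n i) n.
by rewrite /= eqxx mulr1; apply => i /negbTE ->; rewrite mulr0.
Qed.

Lemma metric1_basis m n (x : l2 R) a : metric1 m x (a *: l2_basis n) = m n * a ^+ 2.
Proof.
rewrite /metric1; apply: cvg_lim => //.
have := @series_single_cvg (fun i => m i * (a *: l2_basis n) i * (a *: l2_basis n) i) n.
have E i : (a *: l2_basis n) i = a * (i == n)%:R by [].
rewrite !E eqxx mulr1 -mulrA -expr2; apply => i /negbTE ni.
by rewrite E ni !mulr0.
Qed.

(** Subadditivity of the square root separates the contributions of the two metrics to the speed. *)
Lemma sqrt_sum_le (G E P W : R) : 0 <= E -> 0 <= P -> 0 <= W ->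
  G <= E ^+ 2 + P * W ^+ 2 -> Num.sqrt G <= E + Num.sqrt P * W.
Proof.
move=> E0 P0 W0 GE.
have S0 : 0 <= Num.sqrt P * W by rewrite mulr_ge0 ?sqrtr_ge0.
rewrite -[leRHS]ger0_norm ?addr_ge0// -sqrtr_sqr; apply: ler_wsqrtr.
apply: le_trans GE _; rewrite sqrrD exprMn sqr_sqrtr// -addrA lerD2l lerDr.
by rewrite mulrn_wge0// mulr_ge0.
Qed.

Lemma bump_path_eq (x w b : l2 R) (t : R) :
  quad x (w + b) (- b) t = x + t *: w + (t * (1 - t)) *: b.
Proof.
rewrite /quad scalerDr scalerN mulrBr mulr1 -expr2 scalerBl.
by rewrite !addrA.
Qed.

(** The sum is arranged as the splitting for the infimal convolution: the multiple of [b] is charged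
    to [metric1], and [w] to [metric2]. *)
Lemma bump_path_derive (x w b : l2 R) (t : R) :
  derive1 (quad x (w + b) (- b)) t = (1 - 2 * t) *: b + w.
Proof.
rewrite quad_derive1 /quad scaler0 addr0 scalerN scalerN scalerA scalerBl scale1r.
by rewrite -addrA addrC (mulrC t).
Qed.

Lemma infimal_convolution_vanishing m (f : R -> R) :
  (forall i, 0 < m i) -> m i @[i --> \oo] --> 0 ->
  (forall s, 0 <= s -> 0 < f s) ->
  (exists M, forall s, 0 <= s -> `|f s| <= M) ->
  f s @[s --> +oo] --> 0 ->
  vanishing_dist (infimal_convolution (metric1 m) (metric2 f)).
Proof.
move=> m0 mc f0 [M fM] fc x y; apply/eqP; rewrite eq_le geodesic_dist_ge0 andbT.
apply/lee_addgt0Pr => e e0; rewrite add0e.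
(* One third each for the [metric1] part, the [metric2] part in the middle, and the [metric2] part
   near the ends. *)
pose h := e / 3; have h0 : 0 < h by rewrite divr_gt0.
pose w := y - x; pose W := `|w|; have W0 : 0 <= W by exact: normr_ge0.
have M0 : 0 <= M by exact: le_trans (fM 0 (lexx _)).
pose C := Num.sqrt M * W; have C0 : 0 <= C by rewrite mulr_ge0 ?sqrtr_ge0.
(* [C] bounds the [metric2] speed everywhere, and this [d] gives [C * (2 * d) <= h]; the [h] in the
   denominator covers [C = 0] and yields [d <= 1 / 2]. *)
pose d := h / (2 * (C + h)).
have Ch0 : 0 < C + h by rewrite ltr_wpDl.
have d0 : 0 < d by rewrite divr_gt0// mulr_gt0.
have d12 : d <= 1 / 2.
  rewrite /d ler_pdivrMr ?mulr_gt0//; lra.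
have Cd : C * (2 * d) <= h.
  rewrite /d (_ : C * _ = h * (C / (C + h))); last by field; rewrite gt_eqF.
  by rewrite ler_piMr ?(ltW h0)// ler_pdivrMr// mul1r lerDl ltW.
(* Bound wanted for the square root of [f] in the middle; [W + 1] is positive even when x = y. *)
pose th := h / (W + 1).
have th0 : 0 < th by rewrite divr_gt0// ltr_wpDl.
have thW : th * W <= h.
  by rewrite /th -mulrA ler_piMr ?(ltW h0)// mulrC ler_pdivrMr ?ltr_wpDl// mul1r lerDl.
have [A fA] : exists A, forall s, A < s -> f s <= th ^+ 2.
  have th20 : 0 < th ^+ 2 by rewrite exprn_gt0.
  move/cvgrPdist_lt : fc => /(_ _ th20)[A [_ fA]].
  exists A => s /fA; rewrite sub0r normrN => /ltW; exact: le_trans (ler_norm _).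
(* For [d <= t <= 1 - d] one has [t * (1 - t) >= d / 2], so the bump has norm at least
   [|x| + W + |A| + 1], which forces [|c t| >= |A| + 1]. *)
pose lam := 2 * (`|x| + W + `|A| + 1) / d.
have N0 : 0 < `|x| + W + `|A| + 1 by rewrite ltr_wpDl// !addr_ge0.
have lam0 : 0 < lam by rewrite divr_gt0// mulr_gt0.
(* The direction is chosen after its amplitude, so that [m n] can absorb [lam ^+ 2]. *)
have [n mn] : exists n, lam ^+ 2 * m n <= h ^+ 2.
  have hl0 : 0 < h ^+ 2 / lam ^+ 2 by rewrite divr_gt0// exprn_gt0.
  move/cvgrPdist_lt : mc => /(_ _ hl0)[n _ /(_ n (leqnn n))].
  rewrite sub0r normrN gtr0_norm// ltr_pdivlMr ?exprn_gt0// => /ltW mn.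
  by exists n; rewrite mulrC.
pose b : l2 R := lam *: l2_basis n.
have nb : `|b| = lam by rewrite normrZ l2_basis_norm mulr1 gtr0_norm.
pose c := quad x (w + b) (- b).
have G10 z u : 0 <= metric1 m z u.
  apply: le_trans (metric1_ge_coord m z u 0%N m0 mc).
  by rewrite mulr_ge0 ?sqr_ge0// ltW.
have G20 z u : 0 <= metric2 f z u.
  by rewrite mulr_ge0 ?l2_dot_ge0// ltW// f0// sqr_ge0.
pose G := infimal_convolution (metric1 m) (metric2 f).
have Gle t : 0 <= t <= 1 ->
    G (c t) (derive1 c t) <= h ^+ 2 + f (`|c t| ^+ 2) * W ^+ 2.
  move=> /andP[t0 t1]; rewrite /c bump_path_derive.
  apply: le_trans (infimal_convolution_le _ _ _ _ _ (G10 _) (G20 _)) _.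
  rewrite /metric2 -l2_normE lerD2r /b scalerA metric1_basis.
  apply: le_trans mn; rewrite mulrC ler_pM2r// exprMn ler_piMl ?sqr_ge0//.
  have p0 : 0 <= t * (1 - t) by rewrite mulr_ge0// subr_ge0.
  rewrite (_ : (1 - 2 * t) ^+ 2 = 1 - 4 * (t * (1 - t))); last by ring.
  lra.
apply: (@le_trans _ _ (path_length G c)).
  apply: ereal_inf_lbound; exists c => //; split.
  - exact: quad_piecewise_smooth.
  - by rewrite /c bump_path_eq mul0r !scale0r !addr0.
  - by rewrite /c bump_path_eq subrr mulr0 scale0r addr0 scale1r addrC subrK.
apply: (@le_trans _ _ ((2 * h) + C * (2 * d))%:E); last first.
  by rewrite lee_fin; have := Cd; rewrite /h; lra.
apply: le_integral_end_bumps => //.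
- by rewrite mulr_ge0// ltW.
- move=> t t01.
  apply: le_trans (sqrt_sum_le _ h _ W (ltW h0) _ W0 (Gle t t01)) _.
    by rewrite ltW// f0// sqr_ge0.
  apply: lerD; first by rewrite ler_peMl ?(ltW h0)// ler1n.
  by rewrite ler_wpM2r// ler_wsqrtr// (le_trans (ler_norm _))// fM// sqr_ge0.
- move=> t /andP[dt td].
  have t01 : 0 <= t <= 1 by apply/andP; split; lra.
  apply: le_trans (sqrt_sum_le _ h _ W (ltW h0) _ W0 (Gle t t01)) _.
    by rewrite ltW// f0// sqr_ge0.
  rewrite mulr2n mulrDl mul1r lerD2l; apply: le_trans thW; rewrite ler_wpM2r//.
  rewrite -[leRHS]gtr0_norm// -sqrtr_sqr; apply: ler_wsqrtr; apply: fA.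
  (* One factor is at least 1/2 and the other at least [d]. *)
  have tt : d / 2 <= t * (1 - t).
    have [t12|t12] := leP t (1 / 2); last rewrite mulrC [t * _]mulrC.
      by apply: ler_pM; lra.
    by rewrite mulrC; apply: ler_pM; lra.
  have cA : `|A| + 1 <= `|c t|.
    have bt : `|(t * (1 - t)) *: b| <= `|c t| + `|x| + W.
      have -> : (t * (1 - t)) *: b = c t - x - t *: w.
        by rewrite /c bump_path_eq -addrA -opprD addrAC subrr add0r.
      apply: le_trans (ler_normB _ _) _; apply: lerD; first exact: ler_normB.
      by rewrite normrZ ger0_norm ?ler_piMl//; lra.
    move: bt; rewrite normrZ nb ger0_norm; last by lra.
    have : d / 2 * lam <= t * (1 - t) * lam by rewrite ler_pM2r.
    rewrite {1}/lam (_ : d / 2 * _ = `|x| + W + `|A| + 1); last by field; rewrite gt_eqF.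
    lra.
  (* [f] is evaluated at the squared norm; as [|c t| >= 1], the square is at least [|c t|] and so
     exceeds [A]. *)
  apply: (@lt_le_trans _ _ (`|A| + 1)); first by rewrite ltr_pwDr// ler_norm.
  have c1 : 1 <= `|c t| by apply: le_trans cA; rewrite lerDr.
  apply: le_trans cA _; rewrite expr2 ler_peMl//.
Qed.

End Vanishing.

Theorem theorem3p2 (R : realType) (m : nat -> R) (f : R -> R)
    (m_gt0 : forall i, 0 < m i)
    (m_cvg0 : m i @[i --> \oo] --> 0)
    (f_gt0 : forall x, 0 <= x -> 0 < f x)
    (f_smooth : smooth_on [set x | 0 <= x] f)
    (f_bounded : exists M, forall x, 0 <= x -> `|f x| <= M)
    (f_cvg0 : f x @[x --> +oo] --> 0) :
  let G1 := metric1 m in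
  let G2 := metric2 f in
  let G := infimal_convolution G1 G2 in
  [/\ nondegenerate_dist G1, nondegenerate_dist G2 & vanishing_dist G].
Proof.
split.
- exact: metric1_nondegenerate.
- exact: metric2_nondegenerate.
- exact: infimal_convolution_vanishing.
Qed.
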